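(* Let $\mathrm{SPD}(n)$ carry the Bures-Wasserstein metric. Let $\Sigma,\Lambda\in\mathrm{SPD}(n)$ be commuting matrices, written $\Sigma=PDP^\top$ and $\Lambda=P\Delta P^\top$ with $P\in\mathrm{O}(n)$, $D=\mathrm{Diag}(d_1,\dots,d_n)$, $\Delta=\mathrm{Diag}(\delta_1,\dots,\delta_n)$. Then the parallel transport from $\Sigma$ to $\Lambda$ along the Bures-Wasserstein geodesic joining them is, for all $X\in T_\Sigma\mathrm{SPD}(n)=\mathrm{Sym}(n)$, $$\Pi_{\Sigma\to\Lambda}X=P\left[\sqrt{\frac{\delta_i+\delta_j}{d_i+d_j}}\,[P^\top XP]_{ij}\right]_{1\le i,j\le n}P^\top .$$
   Context: $\mathrm{SPD}(n)$ is the manifold of real symmetric positive definite $n\times n$ matrices, an open subset of the space $\mathrm{Sym}(n)$ of symmetric matrices; tangent spaces are identified with $\mathrm{Sym}(n)$. The Bures-Wasserstein metric is $g_\Sigma(X,X)=\frac12\sum_{i,j}\frac{1}{d_i+d_j}X_{ij}'^2$ where $\Sigma=PDP^\top$ with $P\in\mathrm{O}(n)$, $D=\mathrm{Diag}(d_1,\dots,d_n)$ and $X'=P^\top XP$. The geodesic from $\Sigma$ to $\Lambda$ is $\gamma(t)=\gamma^h(t)\gamma^h(t)^\top$, $t\in[0,1]$, with $\gamma^h(t)=(1-t)\Sigma^{1/2}+t\Sigma^{-1/2}(\Sigma^{1/2}\Lambda\Sigma^{1/2})^{1/2}$; for commuting $\Sigma,\Lambda$ this is $\gamma(t)=((1-t)\Sigma^{1/2}+t\Lambda^{1/2})^2$.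 Parallel transport is with respect to the Levi-Civita connection of $g$. $[M_{ij}]_{i,j}$ denotes the matrix with coefficients $M_{ij}$. *)

(* Defs.v *)
From HB Require Import structures.
From mathcomp Require Import all_boot all_order all_algebra.
From mathcomp Require Import all_classical all_reals all_analysis.

Set Implicit Arguments.
Unset Strict Implicit.
Unset Printing Implicit Defensive.

Import Order.TTheory GRing.Theory Num.Theory.
Import numFieldNormedType.Exports.

Local Open Scope classical_set_scope.
Local Open Scope ring_scope.

Section Matrices.
Variables (R : realType) (n : nat).
Local Notation M := 'M[R]_n.

Definition symmx : set M := [set A | A^T = A].

Definition SPD : set M :=
  [set S | symmx S /\ forall u : 'rV[R]_n, u != 0 -> 0 < (u *m S *m u^T) 0 0].

Definition orthogonalmx (P : M) : Prop := P^T *m P = 1%:M.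

(* On SPD matrices, the unique SPD square root; junk elsewhere. *)
Definition sqrtmx (S : M) : M := xget 0 [set T | SPD T /\ T *m T = S].

Definition diagonalizes (S : M) (Pd : M * 'rV[R]_n) : Prop :=
  orthogonalmx Pd.1 /\ S = Pd.1 *m diag_mx Pd.2 *m Pd.1^T.

(* The bilinear form obtained by polarization from
     X |-> 1/2 sum_ij X'_ij ^ 2 / (d_i + d_j),  X' = P^T X P,  S = P Diag(d) P^T.
   The pair (P, d) is a chosen one; bw_metricE shows that the value does not
   depend on the choice. *)
Definition bw_metric (S X Y : M) : R :=
  let Pd := xget (1%:M, 0) (diagonalizes S) in
  let P := Pd.1 in let d := Pd.2 in
  2^-1 * \sum_i \sum_j
    (P^T *m X *m P) i j * (P^T *m Y *m P) i j / (d 0 i + d 0 j).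

Definition bw_geodesic (S L : M) (t : R) : M :=
  let h := (1 - t) *: sqrtmx S +
    t *: (invmx (sqrtmx S) *m sqrtmx (sqrtmx S *m L *m sqrtmx S)) in
  h *m h^T.

Lemma bw_metricE (P : M) (d : 'rV[R]_n) (X Y : M) : orthogonalmx P ->
  bw_metric (P *m diag_mx d *m P^T) X Y = 2^-1 * \sum_i \sum_j
    (P^T *m X *m P) i j * (P^T *m Y *m P) i j / (d 0 i + d 0 j).
Proof.
move=> oP; rewrite /bw_metric.
have : diagonalizes (P *m diag_mx d *m P^T)
    (xget (1%:M, 0) (diagonalizes (P *m diag_mx d *m P^T))).
  by apply: (@xgetPex _ _ (diagonalizes _)); exists (P, d).
case: (xget _ _) => Q e [/= oQ PQ]; congr (_ * _).
have PPT : P *m P^T = 1%:M by apply: mulmx1C.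
have QQT : Q *m Q^T = 1%:M by apply: mulmx1C.
pose W := P^T *m Q.
have WWT : W *m W^T = 1%:M.
  by rewrite /W trmx_mul trmxK mulmxA -(mulmxA P^T) QQT mulmx1.
have PW : P *m W = Q by rewrite /W mulmxA PPT mul1mx.
have dW i k : d 0 i * W i k = W i k * e 0 k.
  have : diag_mx d *m W = W *m diag_mx e.
    have := congr1 (fun A => P^T *m A *m Q) PQ.
    rewrite !mulmxA oP mul1mx -(mulmxA _ P^T Q) -/W => ->.
    by rewrite -!mulmxA oQ mulmx1 !mulmxA.
  by move/matrixP/(_ i k); rewrite mul_diag_mx mul_mx_diag !mxE.
have conjE (A : M) : Q^T *m A *m Q = W^T *m (P^T *m A *m P) *m W.
  by rewrite -{1 2}PW trmx_mul !mulmxA.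
move: W WWT dW conjE {PW} => W WWT dW conjE.
pose Z (B : M) (c : 'rV[R]_n) : M := \matrix_(i, j) (B i j / (c 0 i + c 0 j)).
have sumE (A B : M) (c : 'rV[R]_n) :
    \sum_i \sum_j A i j * B i j / (c 0 i + c 0 j) = \tr (A^T *m Z B c).
  rewrite /mxtrace exchange_big /=; apply: eq_bigr => j _.
  by rewrite mxE; apply: eq_bigr => i _; rewrite !mxE mulrA.
have ZW (B : M) : Z (W^T *m B *m W) e = W^T *m Z B d *m W.
  apply/matrixP => k l; rewrite !mxE mulr_suml; apply: eq_bigr => j _.
  rewrite !mxE !mulr_suml; apply: eq_bigr => i _; rewrite !mxE.
  have [->|Wik] := eqVneq (W i k) 0; first by rewrite !mul0r.
  have [->|Wjl] := eqVneq (W j l) 0; first by rewrite !mulr0 !mul0r.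
  have -> : e 0 k = d 0 i by apply: (mulfI Wik); rewrite -dW mulrC.
  have -> : e 0 l = d 0 j by apply: (mulfI Wjl); rewrite -dW mulrC.
  by rewrite mulrA mulrAC.
rewrite !sumE !conjE ZW !trmx_mul !trmxK.
rewrite !mulmxA -(mulmxA _ W W^T) WWT mulmx1.
rewrite -!mulmxA mxtrace_mulC -!mulmxA WWT mulmx1.
by rewrite !mulmxA.
Qed.

(* Fields on SPD(n) are represented by total functions on matrices of which
   only the restriction to SPD(n) matters.  SPD(n) being open in Sym(n), a
   function on it is C^(k+1) iff it is continuous and its directional
   derivatives along Sym(n) exist and are C^k. *)
Fixpoint class_C (W : normedModType R) (k : nat) (f : M -> W) : Prop :=
  {within SPD, continuous f} /\
  if k is k'.+1 then
    forall A, symmx A ->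
      (forall S, SPD S -> derivable f S A) /\ class_C k' (fun S => 'D_A f S)
  else True.

Definition smooth (W : normedModType R) (f : M -> W) : Prop :=
  forall k, class_C k f.

Definition vector_field (X : M -> M) : Prop :=
  smooth X /\ forall S, SPD S -> symmx (X S).

Definition lie_bracket (X Y : M -> M) : M -> M :=
  fun S => 'D_(X S) Y S - 'D_(Y S) X S.

Record affine_connection (nabla : (M -> M) -> (M -> M) -> M -> M) : Prop := {
  connection_field : forall X Y, vector_field X -> vector_field Y ->
    vector_field (nabla X Y);
  connection_linear : forall (f : M -> R) X X' Y S, smooth f ->
    vector_field X -> vector_field X' -> vector_field Y -> SPD S ->
    nabla (fun T => f T *: X T + X' T) Y S = f S *: nabla X Y S + nabla X' Y S;
  connection_add : forall X Y Y' S,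
    vector_field X -> vector_field Y -> vector_field Y' -> SPD S ->
    nabla X (fun T => Y T + Y' T) S = nabla X Y S + nabla X Y' S;
  connection_leibniz : forall (f : M -> R) X Y S, smooth f ->
    vector_field X -> vector_field Y -> SPD S ->
    nabla X (fun T => f T *: Y T) S = 'D_(X S) f S *: Y S + f S *: nabla X Y S
}.

Record levi_civita (g : M -> M -> M -> R)
    (nabla : (M -> M) -> (M -> M) -> M -> M) : Prop := {
  levi_civita_connection : affine_connection nabla;
  levi_civita_torsion_free : forall X Y S,
    vector_field X -> vector_field Y -> SPD S ->
    nabla X Y S - nabla Y X S = lie_bracket X Y S;
  levi_civita_metric : forall X Y Z S,
    vector_field X -> vector_field Y -> vector_field Z -> SPD S ->
    'D_(X S) (fun T => g T (Y T) (Z T)) S =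
      g S (nabla X Y S) (Z S) + g S (Y S) (nabla X Z S)
}.

(* Covariant derivative of V along the curve c.  Sym(n) is a global chart whose
   coordinate fields are the constant ones: for V = sum_k V^k E_k with E_k
   constant, DV/dt = sum_k ((V^k)' E_k + V^k nabla_(c') E_k), and nabla_(c') E_k
   at c(t) may be computed with the constant extension of c'(t). *)
Definition covariant_derive (nabla : (M -> M) -> (M -> M) -> M -> M)
    (c V : R -> M) (t : R) : M :=
  'D_1 V t + nabla (cst ('D_1 c t)) (cst (V t)) (c t).

(* Y is obtained from X by parallel transport along c : [0, 1] -> SPD(n). *)
Definition parallel_transport (nabla : (M -> M) -> (M -> M) -> M -> M)
    (c : R -> M) (X Y : M) : Prop :=
  exists V : R -> M,
    [/\ forall t, t \in `[0, 1] -> symmx (V t),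
        {within `[0, 1], continuous V},
        forall t, t \in `]0, 1[ ->
          derivable V t 1 /\ covariant_derive nabla c V t = 0,
        V 0 = X & V 1 = Y].

End Matrices.

(* Main.v *)
Require Import Defs.
From HB Require Import structures.
From mathcomp Require Import all_boot all_order all_algebra.
From mathcomp Require Import all_classical all_reals all_analysis.
From mathcomp Require Import complex ring lra.

Import Order.TTheory GRing.Theory Num.Theory.
Import numFieldNormedType.Exports.

Set Implicit Arguments.
Unset Strict Implicit.
Unset Printing Implicit Defensive.

Local Open Scope classical_set_scope.
Local Open Scope ring_scope.

(* Put L_S(Z) = S Z + Z S.  For S in SPD(n) this is a bijection of Sym(n), and
   g_S(L_S(Z), Y) = tr(Z Y) / 2.  Differentiating the equation L_S(Z) = X in S
   gives the derivative of the metric along a line, and the Koszul formula for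
   constant fields, whose brackets vanish, becomes
     nabla_(L_S(Z)) L_S(W) = - (Z S W + W S Z)   at S.
   The geodesic between commuting matrices is P Diag(a(t)) P^T with
   a_i = ((1 - t) sqrt d_i + t sqrt delta_i)^2.  In the frame P the transport
   equation decouples into
     v_ij' = (a_i' + a_j') / (2 (a_i + a_j)) v_ij,
   so that v_ij / sqrt (a_i + a_j) is constant. *)

(** * Real symmetric matrices *)

Lemma sqnorm_ge0 (R : realDomainType) n (u : 'rV[R]_n) :
  0 <= (u *m u^T) 0 0.
Proof.
by rewrite mxE; apply: sumr_ge0 => i _; rewrite mxE -expr2 sqr_ge0.
Qed.

Lemma sqnorm_gt0 (R : realDomainType) n (u : 'rV[R]_n) :
  u != 0 -> 0 < (u *m u^T) 0 0.
Proof.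
move=> u0; rewrite lt_neqAle sqnorm_ge0 andbT eq_sym; apply: contraNneq u0.
rewrite mxE => /eqP; rewrite psumr_eq0; last first.
  by move=> i _; rewrite mxE -expr2 sqr_ge0.
move=> /allP u0; apply/eqP/rowP => i.
by have := u0 i (mem_index_enum i); rewrite !mxE mulf_eq0 orbb => /eqP.
Qed.

(* The real and imaginary parts x, y of a complex eigenvector for a + i b satisfy
   x A = a x - b y and y A = b x + a y; comparing x A y^T with y A x^T yields
   b = 0. *)
Lemma sym_eigenvector (R : rcfType) n (A : 'M[R]_n.+1) : A^T = A ->
  exists a, exists2 v : 'rV[R]_n.+1, v != 0 & v *m A = a *: v.
Proof.
move=> symA.
pose A' := map_mx (real_complex R) A.
have [l /eigenvalueP[v vA v0]] : exists l, eigenvalue A' l.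
  have [|l hl] := closed_rootP (char_poly A') _.
    by rewrite size_char_poly.
  by exists l; rewrite eigenvalue_root_char.
case: l vA => a b vA.
pose x := map_mx (@complex.Re R) v; pose y := map_mx (@complex.Im R) v.
have xA : x *m A = a *: x - b *: y.
  apply/rowP => j; have := congr1 (fun B : 'rV[R[i]]_n.+1 => complex.Re (B 0 j)) vA.
  rewrite !mxE (raddf_sum (@complex.Re R)); case: (v 0 j) => p q /= <-.
  apply: eq_bigr => i _; rewrite !mxE; case: (v 0 i) => p' q' /=.
  by rewrite mulr0 subr0.
have yA : y *m A = b *: x + a *: y.
  apply/rowP => j; have := congr1 (fun B : 'rV[R[i]]_n.+1 => complex.Im (B 0 j)) vA.
  rewrite !mxE (raddf_sum (@complex.Im R)); case: (v 0 j) => p q /=.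
  rewrite addrC => <-.
  apply: eq_bigr => i _; rewrite !mxE; case: (v 0 i) => p' q' /=.
  by rewrite mulr0 add0r.
have xy0 : x != 0 \/ y != 0.
  have [x0|] := eqVneq x 0; last by left.
  right; apply: contraNneq v0 => y0; apply/eqP/rowP => j.
  have := congr1 (fun B : 'rV[R]_n.+1 => B 0 j) y0.
  have := congr1 (fun B : 'rV[R]_n.+1 => B 0 j) x0.
  by rewrite !mxE; case: (v 0 j) => p q /= -> ->.
have b0 : b = 0.
  have : (x *m A *m y^T) 0 0 = (y *m A *m x^T) 0 0.
    by rewrite -[in LHS](trmxK (x *m A *m y^T)) mxE !trmx_mul trmxK symA mulmxA.
  rewrite xA yA mulmxBl mulmxDl -!scalemxAl !mxE.
  have -> : \sum_j y 0 j * x^T j 0 = \sum_j x 0 j * y^T j 0.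
    by apply: eq_bigr => i _; rewrite !mxE mulrC.
  have x2 := sqnorm_ge0 x; have y2 := sqnorm_ge0 y; rewrite mxE in x2.
  rewrite mxE in y2; move: (\sum_j x 0 j * y^T j 0) => s e.
  have {}e : b * ((x *m x^T) 0 0 + (y *m y^T) 0 0) = 0.
    rewrite !mxE; lra.
  apply/eqP; move/eqP: e; rewrite mulf_eq0 => /orP[//|/eqP e].
  rewrite !mxE in e; case: xy0 => /sqnorm_gt0; rewrite mxE;
    move: x2 y2 e; move: (\sum_j _) (\sum_j _) => p q; clear; lra.
case: xy0 => h; [exists a, x|exists a, y] => //.
  by rewrite xA b0 scale0r subr0.
by rewrite yA b0 scale0r add0r.
Qed.

(* H is the reflection exchanging v / |v| and the first basis vector. *)
Lemma householder (R : rcfType) n (v : 'rV[R]_n.+1) : v != 0 ->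
  exists2 H : 'M[R]_n.+1, H^T *m H = 1%:M &
    exists2 c, c != 0 & v = c *: row 0 H.
Proof.
move=> v0; have v2 := sqnorm_gt0 v0.
pose c := Num.sqrt ((v *m v^T) 0 0).
have c0 : 0 < c by rewrite sqrtr_gt0.
pose u := c^-1 *: v.
have uu : u *m u^T = 1%:M.
  rewrite /u linearZ /= -scalemxAl -scalemxAr scalerA; apply/matrixP => i j.
  rewrite !ord1 mxE -(sqr_sqrtr (ltW v2)) -/c [RHS]mxE eqxx mulr1n.
  by field; rewrite gt_eqF.
have vu : v = c *: u by rewrite scalerA divff ?scale1r // gt_eqF.
suff [H HH Hu] : exists2 H : 'M[R]_n.+1, H^T *m H = 1%:M & row 0 H = u.
  by exists H => //; exists c; rewrite ?gt_eqF // Hu.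
clear - uu.
pose e : 'rV[R]_n.+1 := row 0 1%:M.
have [ue|ue] := eqVneq u e; first by exists 1%:M; rewrite ?trmx1 ?mulmx1.
have [w wE] : exists w, w = u - e by exists (u - e).
have w2 : 0 < (w *m w^T) 0 0 by apply: sqnorm_gt0; rewrite wE subr_eq0.
pose k := (w *m w^T) 0 0.
have wwE : w *m w^T = k%:M.
by apply/matrixP => i j; rewrite !ord1 [RHS]mxE eqxx mulr1n.
have eeE : e *m e^T = 1%:M.
  apply/matrixP => i j; rewrite !ord1 /e row1 trmx_delta mul_delta_mx.
  by rewrite !mxE !eqxx.
have uet : u *m e^T = e *m u^T.
  apply/matrixP => i j; rewrite !ord1 -[in LHS](trmxK (u *m e^T)) mxE.
  by rewrite trmx_mul trmxK.
pose s := (e *m u^T) 0 0.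
have euE : e *m u^T = s%:M.
  by apply/matrixP => i j; rewrite !ord1 [RHS]mxE eqxx mulr1n.
(* As [u] and [e] are unit vectors, |u - e|^2 = 2 (1 - s). The reflection below then sends [e] to e
   - (2 / k) (s - 1) w = e + w = u. *)
have keE : k = 2 * (1 - s).
  rewrite /k wE linearB /= mulmxBl !mulmxBr uu eeE uet euE !mxE eqxx !mulr1n; ring.
exists (1%:M - (2 / k) *: (w^T *m w)).
  rewrite [(_ - _)^T]linearB /= [(_ *: _)^T]linearZ /= trmx_mul trmxK trmx1.
  rewrite mulmxBl !mulmxBr !mulmx1 mul1mx.
  rewrite -scalemxAl -scalemxAr mulmxA -(mulmxA w^T w) wwE mul_mx_scalar.
  rewrite -!scalemxAl !scalerA -addrA -[RHS]addr0; congr (_ + _).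
  rewrite opprB addrC -addrA -opprD -scalerDl -scalerBl.
  set a := (X in X *: _); suff -> : a = 0 by rewrite scale0r.
  rewrite /a; field; exact: lt0r_neq0.
rewrite linearB linearZ /= row_mul -/e.
have -> : row 0 w^T *m w = (s - 1) *: w.
  have -> : row 0 w^T = e *m w^T by rewrite /e -row_mul mul1mx.
  have -> : e *m w^T = (s - 1)%:M.
    by rewrite wE linearB /= mulmxBr eeE euE raddfB.
  by rewrite mul_scalar_mx.
rewrite scalerA.
have -> : 2 / k * (s - 1) = -1.
  have k0 : k != 0 by exact: lt0r_neq0.
  rewrite keE; field.
  by move: k0; rewrite keE mulf_eq0 negb_or => /andP[].
by rewrite scaleN1r opprK wE addrC subrK.
Qed.

(** Induction on the dimension. A reflection [H] whose first row is proportional to an eigenvector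
    makes [H A H^T] block diagonal with a leading block of size one; the induction hypothesis
    diagonalizes the other block. *)
Lemma sym_diagonalizable (R : rcfType) n (A : 'M[R]_n) : A^T = A ->
  exists (P : 'M[R]_n) (d : 'rV[R]_n), P^T *m P = 1%:M /\ A = P *m diag_mx d *m P^T.
Proof.
elim: n A => [|n IHn] A symA.
  by exists 1%:M, 0; split; apply/matrixP => -[].
have [a [v v0 vA]] := sym_eigenvector symA.
have [H HH [c c0 vH]] := householder v0.
have HHT : H *m H^T = 1%:M by apply: mulmx1C.
pose B : 'M[R]_(1 + n) := H *m A *m H^T.
have symB : B^T = B by rewrite /B !trmx_mul trmxK symA mulmxA.
have row0B : row 0 B = a *: row 0 1%:M.
  rewrite /B !row_mul; have -> : row 0 H *m A = a *: row 0 H.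
    apply: (scalerI c0); rewrite scalemxAl -vH vA vH !scalerA; congr (_ *: _).
    exact: mulrC.
  by rewrite -scalemxAl -row_mul HHT.
have AE : A = H^T *m B *m H.
  by rewrite /B !mulmxA HH mul1mx -mulmxA HH mulmx1.
move: (B) symB row0B AE => {}B symB row0B AE.
have B0j j : B 0 (rshift 1 j) = 0.
  have := congr1 (fun x : 'rV[R]_(1 + n) => x 0 (rshift 1 j)) row0B.
  by rewrite !mxE /= => ->; rewrite mulr0.
have B00 : B 0 0 = a.
  have := congr1 (fun x : 'rV[R]_(1 + n) => x 0 0) row0B.
  by rewrite !mxE eqxx mulr1.
have lsh0 : lshift n 0 = 0 :> 'I_(1 + n) by apply/val_inj.
have BE : B = block_mx a%:M 0 0 (drsubmx B).
  rewrite -[LHS](submxK B); congr block_mx; apply/matrixP => i j.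
  - by rewrite !ord1 !mxE !lsh0 B00 eqxx.
  - by rewrite !ord1 !mxE lsh0 B0j.
  - by rewrite !ord1 !mxE lsh0 -[B _ _]/(B _ 0) -symB mxE B0j.
have symB' : (drsubmx B)^T = drsubmx B by rewrite trmx_drsub symB.
have [Q [d [oQ BQ]]] := IHn _ symB'.
pose Q1 : 'M[R]_(1 + n) := block_mx 1%:M 0 0 Q.
pose d1 : 'rV[R]_(1 + n) := row_mx a%:M d.
have trQ1 : Q1^T = block_mx 1%:M 0 0 Q^T by rewrite tr_block_mx !trmx0 trmx1.
have oQ1 : Q1^T *m Q1 = 1%:M.
  rewrite trQ1 mulmx_block !(mulmx0, mul0mx) !(addr0, add0r) mulmx1 oQ.
  by rewrite -scalar_mx_block.
have BQ1 : B = Q1 *m diag_mx d1 *m Q1^T.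
  have -> : diag_mx d1 = block_mx a%:M 0 0 (diag_mx d).
    rewrite diag_mx_row; congr block_mx; apply/matrixP => i j.
    by rewrite !ord1 !mxE eqxx.
  rewrite trQ1 !mulmx_block !(mulmx0, mul0mx) !(addr0, add0r) mulmx1 mul1mx.
  by rewrite !mul0mx -BQ.
exists (H^T *m Q1), d1; rewrite trmx_mul trmxK !mulmxA.
split; first by rewrite -(mulmxA _ H) HHT mulmx1.
by rewrite AE BQ1 !mulmxA.
Qed.

(** * The metric and its Levi-Civita connection *)

Section BuresWasserstein.
Variables (R : realType) (n : nat).
Local Notation M := 'M[R]_n.
Implicit Types (S T A B C P V W Z : M) (d : 'rV[R]_n).

(** * Spectral description of SPD(n) *)

Lemma orthogonalmx_mulT P : orthogonalmx P -> P *m P^T = 1%:M.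
Proof. by move=> oP; apply: mulmx1C. Qed.

Lemma symmx_conj P A : symmx A -> symmx (P *m A *m P^T).
Proof. by rewrite /symmx /= => sA; rewrite !trmx_mul trmxK sA mulmxA. Qed.

Lemma qform_diag P d (u : 'rV[R]_n) :
  (u *m (P *m diag_mx d *m P^T) *m u^T) 0 0
  = \sum_i d 0 i * (u *m P) 0 i ^+ 2.
Proof.
have -> : u *m (P *m diag_mx d *m P^T) *m u^T
    = (u *m P) *m diag_mx d *m (u *m P)^T by rewrite trmx_mul !mulmxA.
rewrite mxE; apply: eq_bigr => i _; rewrite mul_mx_diag !mxE; ring.
Qed.

Lemma sqnorm_orthogonal P (u : 'rV[R]_n) : orthogonalmx P ->
  (u *m u^T) 0 0 = \sum_i (u *m P) 0 i ^+ 2.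
Proof.
move=> /orthogonalmx_mulT oP.
have -> : u *m u^T = (u *m P) *m (u *m P)^T.
  by rewrite trmx_mul mulmxA -(mulmxA u) oP mulmx1.
by rewrite mxE; apply: eq_bigr => i _; rewrite [_^T _ _]mxE expr2.
Qed.

Lemma SPD_diag P d : orthogonalmx P ->
  SPD (P *m diag_mx d *m P^T) <-> forall i, 0 < d 0 i.
Proof.
move=> oP; split=> [[_ pS] i|d0].
  (* The i-th column of [P], written as a row: an eigenvector on which the quadratic form takes the
     value [d 0 i]. *)
  pose u : 'rV[R]_n := delta_mx 0 i *m P^T.
  have uP : u *m P = delta_mx 0 i by rewrite -mulmxA oP mulmx1.
  have u0 : u != 0.
    apply/eqP => u0; have := congr1 (fun v : 'rV[R]_n => v 0 i) uP.
    by rewrite u0 mul0mx !mxE !eqxx => /esym/eqP; rewrite oner_eq0.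
  have := pS _ u0; rewrite qform_diag uP (bigD1 i) //= big1 => [|j ji].
    by rewrite mxE !eqxx expr1n mulr1 addr0.
  by rewrite mxE (negbTE ji) andbF expr0n mulr0.
split; first by apply: symmx_conj; rewrite /symmx /= tr_diag_mx.
move=> u /sqnorm_gt0; rewrite qform_diag (sqnorm_orthogonal u oP) => u0.
rewrite lt_neqAle eq_sym sumr_ge0 ?andbT; last first.
  by move=> i _; rewrite mulr_ge0 ?sqr_ge0 ?ltW.
apply: contraTneq u0 => /eqP; rewrite psumr_eq0; last first.
  by move=> i _; rewrite mulr_ge0 ?sqr_ge0 ?ltW.
move=> /allP u0; rewrite big1 ?ltxx // => i _.
have := u0 i (mem_index_enum i).
by rewrite mulf_eq0 gt_eqF //= => /eqP.
Qed.

Lemma SPD_diagonalizes S : SPD S ->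
  exists (P : M) (d : 'rV[R]_n), [/\ orthogonalmx P, forall i, 0 < d 0 i
    & S = P *m diag_mx d *m P^T].
Proof.
move=> pS; have [P [d [oP SE]]] := sym_diagonalizable (proj1 pS).
by exists P, d; split=> //; apply/(SPD_diag d oP); rewrite -SE.
Qed.

(** * The Lyapunov operator and the metric *)

(** The operator L_T of the opening comment. Tangent vectors at S are written L_S(Z), a form in
    which the metric shows no eigenvalues. *)
Definition lyapunov T Z : M := T *m Z + Z *m T.

Lemma lyapunov_sym T Z : symmx T -> symmx Z -> symmx (lyapunov T Z).
Proof.
by rewrite /symmx /= /lyapunov => sT sZ; rewrite linearD /= !trmx_mul sT sZ addrC.
Qed.

(** Self-adjointness of L_T for the trace form, by cyclicity of the trace. *)
Lemma mxtrace_lyapunov T Z W : \tr (lyapunov T Z *m W) = \tr (Z *m lyapunov T W).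
Proof.
rewrite /lyapunov mulmxDl mulmxDr !mxtraceD addrC mulmxA; congr (_ + _).
by rewrite -mulmxA mxtrace_mulC mulmxA.
Qed.

(** In an eigenframe of S, L_S multiplies the entry (i, j) by d_i + d_j > 0, so a preimage is found
    by entrywise division. *)
Lemma lyapunov_solvable S B : SPD S -> symmx B ->
  exists2 Z, symmx Z & lyapunov S Z = B.
Proof.
move=> /SPD_diagonalizes[P [d [oP d0 ->]]] sB.
have oP' := orthogonalmx_mulT oP.
pose B' := P^T *m B *m P.
have sB' : symmx B' by rewrite /B' -{2}(trmxK P); apply: symmx_conj.
have -> : B = P *m B' *m P^T by rewrite /B' !mulmxA oP' mul1mx -mulmxA oP' mulmx1.
move: B' sB' => {sB}B' sB'.
pose Z' : M := \matrix_(i, j) (B' i j / (d 0 i + d 0 j)).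
exists (P *m Z' *m P^T).
  apply: symmx_conj; apply/matrixP => i j.
  by rewrite !mxE -[in LHS]sB' mxE addrC.
rewrite /lyapunov !mulmxA -!(mulmxA _ P^T P) oP !mulmx1.
rewrite -mulmxDl -(mulmxA P (diag_mx d)) -(mulmxA P Z') -mulmxDr; congr (_ *m _ *m _).
apply/matrixP => i j; rewrite mul_mx_diag mul_diag_mx !mxE.
by field; rewrite gt_eqF // addr_gt0.
Qed.

(** The factors d_i + d_j produced by L_S cancel the denominators of the metric; a trace,
    independent of the frame, remains. *)
Lemma bw_metric_lyapunov S Z C : SPD S -> symmx Z ->
  bw_metric S (lyapunov S Z) C = 2^-1 * \tr (Z *m C).
Proof.
move=> /SPD_diagonalizes[P [d [oP d0 ->]]] sZ.
have oP' := orthogonalmx_mulT oP.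
rewrite bw_metricE //; congr (_ * _).
pose Z' := P^T *m Z *m P; pose C' := P^T *m C *m P.
have sZ' : symmx Z' by rewrite /Z' -{2}(trmxK P); apply: symmx_conj.
have -> : \tr (Z *m C) = \tr (Z' *m C').
  rewrite /Z' /C' !mulmxA -(mulmxA _ P P^T) oP' mulmx1.
  by rewrite [RHS]mxtrace_mulC !mulmxA oP' mul1mx.
rewrite exchange_big /=; apply: eq_bigr => i _; rewrite mxE; apply: eq_bigr => j _.
have -> : P^T *m lyapunov (P *m diag_mx d *m P^T) Z *m P
    = diag_mx d *m Z' + Z' *m diag_mx d.
  rewrite /lyapunov mulmxDr mulmxDl !mulmxA oP mul1mx; congr (_ + _).
  by rewrite -!mulmxA oP mulmx1 !mulmxA.
rewrite mul_mx_diag mul_diag_mx -/C' -[in RHS]sZ' !mxE.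
by field; rewrite gt_eqF // addr_gt0.
Qed.

Lemma bw_metricC S A B : SPD S -> symmx A -> symmx B ->
  bw_metric S A B = bw_metric S B A.
Proof.
move=> pS /(lyapunov_solvable pS)[Z sZ <-] /(lyapunov_solvable pS)[W sW <-].
by rewrite !bw_metric_lyapunov // -mxtrace_lyapunov mxtrace_mulC.
Qed.

(** * Bounds along rays in SPD(n) and the derivative of the metric *)

Lemma sym_qform_bound A : symmx A -> exists2 c, 0 <= c &
  forall u : 'rV[R]_n, `|(u *m A *m u^T) 0 0| <= c * (u *m u^T) 0 0.
Proof.
move=> /sym_diagonalizable[P [d [oP ->]]].
exists (\sum_i `|d 0 i|); first exact: sumr_ge0.
move=> u; rewrite qform_diag (sqnorm_orthogonal _ oP) mulr_sumr.
apply: le_trans (ler_norm_sum _ _ _) _; apply: ler_sum => i _.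
rewrite normrM (ger0_norm (sqr_ge0 _)) ler_wpM2r ?sqr_ge0 //.
by rewrite (bigD1 i) //= lerDl sumr_ge0.
Qed.

Lemma SPD_qform_bound S : SPD S -> exists2 l, 0 < l &
  forall u : 'rV[R]_n, l * (u *m u^T) 0 0 <= (u *m S *m u^T) 0 0.
Proof.
move=> /SPD_diagonalizes[P [d [oP d0 ->]]].
have s0 : 0 <= \sum_i (d 0 i)^-1 by apply: sumr_ge0 => i _; rewrite invr_ge0 ltW.
have l0 : 0 < 1 + \sum_i (d 0 i)^-1 by rewrite ltr_wpDr.
(* The sum dominates each 1 / d_i, so its reciprocal lies below each d_i; the added 1 keeps the
   constant positive in dimension 0 as well. *)
exists (1 + \sum_i (d 0 i)^-1)^-1; first by rewrite invr_gt0.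
move=> u; rewrite qform_diag (sqnorm_orthogonal _ oP) mulr_sumr.
apply: ler_sum => i _; rewrite ler_wpM2r ?sqr_ge0 //.
rewrite invf_ple ?posrE //.
rewrite (bigD1 i) //= addrCA lerDl addr_ge0 //.
by apply: sumr_ge0 => j _; rewrite invr_ge0 ltW.
Qed.

Lemma mxtrace_qform Z T :
  \tr (Z *m T *m Z^T) = \sum_i (row i Z *m T *m (row i Z)^T) 0 0.
Proof.
apply: eq_bigr => i _; rewrite -row_mul !mxE; apply: eq_bigr => j _.
by rewrite !mxE.
Qed.

Lemma mxtrace_sqr_ge0 Z : 0 <= \tr (Z *m Z^T).
Proof.
by rewrite -{1}(mulmx1 Z) mxtrace_qform sumr_ge0 // => i _; rewrite mulmx1 sqnorm_ge0.
Qed.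

(** Expand tr((A + kB)(A + kB)^T) >= 0 at k = 1 and k = -1. *)
Lemma mxtrace_mul_bound A B : symmx B ->
  2 * `|\tr (A *m B)| <= \tr (A *m A^T) + \tr (B *m B^T).
Proof.
rewrite /symmx /= => sB; rewrite sB.
have h (k : R) : 0 <= \tr (A *m A^T) + k ^+ 2 * \tr (B *m B) + 2 * k * \tr (A *m B).
  have := mxtrace_sqr_ge0 (A + k *: B).
  rewrite linearD linearZ /= mulmxDl !mulmxDr !mxtraceD -!scalemxAl -!scalemxAr.
  rewrite !mxtraceZ !sB -[\tr (B *m A^T)]mxtrace_tr.
  by rewrite trmx_mul trmxK sB; lra.
have := h 1; have := h (-1); rewrite sqrrN expr1n.
by case: ler0P => _; lra.
Qed.

(** A bound on the inverse of L_T that depends on T only through l. With N(Z) = tr(Z Z^T), the lower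
    bound on T gives tr(L_T(Z) Z) >= 2 l N(Z). Pairing L_T(Z) with l Z yields 4 l^2 N(Z) <=
    N(L_T(Z)) + l^2 N(Z), whence the constant 3. *)
Lemma lyapunov_bound l T Z : 0 < l -> symmx Z ->
  (forall u : 'rV[R]_n, l * (u *m u^T) 0 0 <= (u *m T *m u^T) 0 0) ->
  3 * l ^+ 2 * \tr (Z *m Z^T) <= \tr (lyapunov T Z *m (lyapunov T Z)^T).
Proof.
move=> l0 sZ lT.
have h1 : 2 * l * \tr (Z *m Z^T) <= \tr (lyapunov T Z *m Z).
  have -> : \tr (lyapunov T Z *m Z) = 2 * \tr (Z *m T *m Z^T).
    rewrite sZ /lyapunov mulmxDl mxtraceD [X in X + _]mxtrace_mulC mulmxA; ring.
  rewrite -mulrA ler_wpM2l //.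
  rewrite mxtrace_qform -{1}(mulmx1 Z) mxtrace_qform mulr_sumr.
  by apply: ler_sum => i _; rewrite mulmx1.
have := @mxtrace_mul_bound (lyapunov T Z) (l *: Z).
have sZl : symmx (l *: Z) by rewrite /symmx /= linearZ /= sZ.
move=> /(_ sZl); rewrite [(_ *: _)^T]linearZ /= -!scalemxAl -!scalemxAr -?scalemxAl !mxtraceZ.
have := ler_norm (l * \tr (lyapunov T Z *m Z)).
move: h1; move: (\tr (lyapunov T Z *m Z)) => x h1 h2 h3.
have : l * (2 * l * \tr (Z *m Z^T)) <= l * x by rewrite ler_wpM2l // ltW.
move: h2 h3; move: (\tr _) (\tr _) `|_| => p q y; clear; lra.
Qed.

Lemma SPD_ray S V : SPD S -> symmx V -> exists l e : R, [/\ 0 < l, 0 < e &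
  forall h, `|h| <= e -> SPD (h *: V + S) /\ forall u : 'rV[R]_n,
    l * (u *m u^T) 0 0 <= (u *m (h *: V + S) *m u^T) 0 0].
Proof.
move=> pS sV; have [l l0 lS] := SPD_qform_bound pS.
have [c c0 cV] := sym_qform_bound sV.
(* For |h| (1 + c) <= l / 2 the form of [h V] uses up at most half of the lower bound [l] of [S];
   the 1 covers the case c = 0. *)
exists (l / 2), (l / 2 / (1 + c)); split; rewrite ?divr_gt0 //.
  by rewrite ltr_pwDl.
move=> h; rewrite ler_pdivlMr ?ltr_pwDl // => he.
have hS (u : 'rV[R]_n) : l / 2 * (u *m u^T) 0 0 <= (u *m (h *: V + S) *m u^T) 0 0.
  have u0 := sqnorm_ge0 u.
  rewrite mulmxDr mulmxDl -scalemxAr -scalemxAl.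
  rewrite [leRHS]mxE [X in _ <= X + _]mxE.
  have := lS u; have := cV u; move: u0.
  move: ((u *m u^T) 0 0) ((u *m V *m u^T) 0 0) ((u *m S *m u^T) 0 0).
  move=> p v s p0 vp sp.
  have : `|h * v| <= l / 2 * p.
    rewrite normrM; apply: le_trans (ler_wpM2l (normr_ge0 h) vp) _.
    rewrite mulrA ler_wpM2r //; apply: le_trans he.
    by rewrite ler_wpM2l // lerDr.
  by rewrite ler_norml => /andP[]; lra.
split=> //; split.
  by rewrite /symmx /= linearD linearZ /= sV (proj1 pS).
move=> u /sqnorm_gt0 u0; apply: lt_le_trans (hS u).
by rewrite mulr_gt0 // divr_gt0.
Qed.

(* The solutions Z' of L_(S + hV)(Z') = L_S(Z) satisfy the exact identity
   L_(S + hV)(Z' - Z) = - h L_V(Z).  Used twice, it expresses the second order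
   remainder through a solution W' that is bounded near h = 0, so that no
   regularity of the eigenvalues is needed. *)
Lemma bw_metric_ray S V Z W : SPD S -> symmx V -> symmx Z -> symmx W ->
  exists K e : R, 0 < e /\ forall h, `|h| <= e ->
    `|bw_metric (h *: V + S) (lyapunov S Z) (lyapunov S W)
      - bw_metric S (lyapunov S Z) (lyapunov S W)
      + h * (2^-1 * \tr (lyapunov V Z *m W))| <= h ^+ 2 * K.
Proof.
move=> pS sV sZ sW; have [l [e [l0 e0 ray]]] := SPD_ray pS sV.
have sS := proj1 pS.
(* Writing L_V(Z) = L_S(Y) lets self-adjointness move L_S onto W' - W, where the exact identity
   applies a second time. *)
have [Y sY YE] := lyapunov_solvable pS (lyapunov_sym sV sZ).
pose N A := \tr (A *m A^T).
(* The remainder is h^2 tr(L_V(Y) W') / 2. The trace is controlled by N(L_V(Y)) and N(W'), and the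
   second term bounds N(W') uniformly in [h]. *)
exists (N (lyapunov V Y) + N (lyapunov S W) / (3 * l ^+ 2)), e; split=> // h he.
have [pT lT] := ray h he.
have [Z' sZ' ZE] := lyapunov_solvable pT (lyapunov_sym sS sZ).
have [W' sW' WE] := lyapunov_solvable pT (lyapunov_sym sS sW).
have lyD A : lyapunov (h *: V + S) A = h *: lyapunov V A + lyapunov S A.
  rewrite /lyapunov mulmxDl mulmxDr -scalemxAl -scalemxAr scalerDr; exact: addrACA.
have lyB T A B : lyapunov T (A - B) = lyapunov T A - lyapunov T B.
  by rewrite /lyapunov mulmxBl mulmxBr opprD; exact: addrACA.
have dZ : lyapunov (h *: V + S) (Z' - Z) = - (h *: lyapunov V Z).
  by rewrite lyB ZE lyD opprD addrC subrK.
have dW : lyapunov S (W' - W) = - (h *: lyapunov V W').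
  by rewrite lyB -WE lyD opprD addrC subrK.
rewrite -{1}ZE !bw_metric_lyapunov // -mulrBr -raddfB /= -mulmxBl.
rewrite -{1}WE -mxtrace_lyapunov dZ mulNmx -scalemxAl raddfN /= mxtraceZ.
have -> : \tr (lyapunov V Z *m W') = \tr (lyapunov V Z *m W)
    - h * \tr (lyapunov V Y *m W').
  apply/eqP; rewrite -subr_eq0 opprB addrA addrAC -raddfB /= -mulmxBr -{1}YE.
  rewrite (mxtrace_lyapunov S) dW mulmxN -scalemxAr raddfN /= mxtraceZ.
  by rewrite -mxtrace_lyapunov addNr.
have -> : 2^-1 * - (h * (\tr (lyapunov V Z *m W) - h * \tr (lyapunov V Y *m W')))
    + h * (2^-1 * \tr (lyapunov V Z *m W)) = h ^+ 2 * (2^-1 * \tr (lyapunov V Y *m W')).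
  by ring.
rewrite normrM (ger0_norm (sqr_ge0 h)) ler_wpM2l ?sqr_ge0 //.
have N0 : 0 <= N W' by exact: mxtrace_sqr_ge0.
have : N W' <= N (lyapunov S W) / (3 * l ^+ 2).
  rewrite ler_pdivlMr; last by rewrite mulr_gt0 // exprn_gt0.
  by rewrite mulrC -WE; exact: lyapunov_bound.
have := mxtrace_mul_bound (lyapunov V Y) sW'; rewrite -!/(N _).
have := mxtrace_sqr_ge0 (lyapunov V Y); rewrite -!/(N _).
rewrite normrM (ger0_norm (x := 2^-1)) ?invr_ge0 //.
move: N0; move: `|_| (N (lyapunov V Y)) (N W') (N (lyapunov S W) / _).
clear => *; lra.
Qed.

Lemma derive_bw_metric S V Z W : SPD S -> symmx V -> symmx Z -> symmx W ->
  'D_V (fun T => bw_metric T (lyapunov S Z) (lyapunov S W)) S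
  = - (2^-1 * \tr (lyapunov V Z *m W)).
Proof.
move=> pS sV sZ sW; have [K [e [e0 KP]]] := bw_metric_ray pS sV sZ sW.
apply/cvg_lim => //; apply/cvgrPdist_le => /= r r0.
near=> h.
have h0 : h != 0 by near: h; exact: nbhs_dnbhs_neq.
have : `|h| <= e by near: h; exact: dnbhs0_le.
move=> /KP; set D := _ - _; set t := 2^-1 * _ => hK.
rewrite -opprD normrN.
have -> : t + h^-1 *: D = h^-1 * (D + h * t).
  by rewrite /GRing.scale /=; field.
rewrite normrM normfV ler_pdivrMl ?normr_gt0 //; apply: le_trans hK _.
rewrite -real_normK ?num_real // expr2 -mulrA ler_wpM2l //.
apply: le_trans (ler_wpM2l (normr_ge0 h) (ler_norm K)) _.
(* The 1 makes the factor positive, so that [r] can be divided by it. *)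
apply: (@le_trans _ _ (`|h| * (1 + `|K|))); first by rewrite ler_wpM2l // lerDr.
rewrite -ler_pdivlMr ?ltr_pwDl //; near: h; apply: dnbhs0_le.
by rewrite divr_gt0 // ltr_pwDl.
Unshelve. all: by end_near. Qed.

(** * The connection on constant fields *)

Lemma smooth_cst (W : normedModType R) (w : W) : smooth (fun _ : M => w).
Proof.
move=> k; elim: k w => [|k IHk] w.
  by split=> //; apply: continuous_subspaceT; exact: cst_continuous.
split; first by exact: continuous_subspaceT (@cst_continuous _ _ w).
move=> A sA; split=> [S _|]; first exact: derivable_cst.
suff -> : (fun S : M => 'D_A (fun=> w) S) = (fun=> 0) by exact: IHk.
by apply/funext => S; rewrite derive_cst.
Qed.

Lemma vector_field_cst A : symmx A -> vector_field (fun=> A).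
Proof. by move=> sA; split=> // k; exact: smooth_cst. Qed.

Variable nabla : (M -> M) -> (M -> M) -> M -> M.
Hypothesis hnabla : levi_civita (@bw_metric R n) nabla.

Lemma nabla_cst_sym S A B : SPD S -> symmx A -> symmx B ->
  symmx (nabla (cst A) (cst B) S).
Proof.
move=> pS /vector_field_cst fA /vector_field_cst fB.
exact: (proj2 (connection_field (levi_civita_connection hnabla) fA fB)).
Qed.

Lemma nabla_cstC S A B : SPD S -> symmx A -> symmx B ->
  nabla (cst A) (cst B) S = nabla (cst B) (cst A) S.
Proof.
move=> pS /vector_field_cst fA /vector_field_cst fB; apply/eqP.
rewrite -subr_eq0 (levi_civita_torsion_free hnabla) // /lie_bracket.
by rewrite !derive_cst subr0.
Qed.

(** The trace form is definite on Sym(n): testing with W = A - B makes a sum of squares vanish. *)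
Lemma mxtrace_sym_inj A B : symmx A -> symmx B ->
  (forall W, symmx W -> \tr (A *m W) = \tr (B *m W)) -> A = B.
Proof.
move=> sA sB AB; apply/eqP; rewrite -subr_eq0.
have sD : symmx (A - B) by rewrite /symmx /= linearB /= sA sB.
have := AB _ sD => /eqP; rewrite -subr_eq0 -raddfB /= -mulmxBl => /eqP e.
have {}e : \tr ((A - B) *m (A - B)^T) = 0 by rewrite sD.
move: e; rewrite /mxtrace => /eqP; rewrite psumr_eq0; last first.
  move=> i _; rewrite mxE; apply: sumr_ge0 => j _.
  by rewrite [_^T _ _]mxE -expr2 sqr_ge0.
move=> /allP e; apply/eqP/matrixP => i j; rewrite [RHS]mxE; apply/eqP.
have := e i (mem_index_enum i); rewrite /= mxE psumr_eq0; last first.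
  by move=> k _; rewrite [_^T _ _]mxE -expr2 sqr_ge0.
move=> /allP /(_ j (mem_index_enum j)).
by rewrite [_^T _ _]mxE /= mulf_eq0 orbb.
Qed.

(** By nondegeneracy of the trace form it is enough to pair both sides with every symmetric [Y]. Up
    to a factor this is the metric against L_S(Y), which the Koszul formula computes. *)
Lemma nabla_cst S Z W : SPD S -> symmx Z -> symmx W ->
  nabla (cst (lyapunov S Z)) (cst (lyapunov S W)) S
  = - (Z *m S *m W + W *m S *m Z).
Proof.
move=> pS sZ sW; have sS := proj1 pS.
have sym A : symmx A -> symmx (lyapunov S A) by exact: lyapunov_sym.
apply: mxtrace_sym_inj.
- by apply: nabla_cst_sym => //; exact: sym.
- rewrite /symmx /= linearN linearD /= !trmx_mul sS sZ sW !mulmxA.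
  by rewrite addrC.
move=> Y sY.
pose A := lyapunov S Z; pose B := lyapunov S W; pose C := lyapunov S Y.
pose G X X' := nabla (cst X) (cst X') S.
have sG X X' : symmx X -> symmx X' -> symmx (G X X') by exact: nabla_cst_sym.
have GC X X' : symmx X -> symmx X' -> G X X' = G X' X by exact: nabla_cstC.
have compat X X1 X2 : symmx X -> symmx X1 -> symmx X2 ->
    - (2^-1 * \tr (lyapunov X X1 *m X2)) =
    bw_metric S (G X (lyapunov S X1)) (lyapunov S X2)
    + bw_metric S (lyapunov S X1) (G X (lyapunov S X2)).
  move=> sX sX1 sX2; rewrite -(derive_bw_metric pS sX sX1 sX2).
  exact: (levi_civita_metric hnabla (vector_field_cst sX)
    (vector_field_cst (sym _ sX1)) (vector_field_cst (sym _ sX2)) pS).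
(* Koszul: once the arguments of [G] and of the metric are exchanged by symmetry, [hA] + [hB] - [hC]
   isolates twice the metric of [G A B] against [C]. *)
have hA := compat A W Y (sym _ sZ) sW sY.
have hB := compat B Z Y (sym _ sW) sZ sY.
have hC := compat C W Z (sym _ sY) sW sZ.
have GE : bw_metric S (G A B) C = 2^-1 * \tr (G A B *m Y).
  rewrite (bw_metricC pS (sG _ _ (sym _ sZ) (sym _ sW)) (sym _ sY)).
  by rewrite bw_metric_lyapunov // mxtrace_mulC.
move: hA hB hC; rewrite -/A -/B -/C.
have sA : symmx A := sym _ sZ; have sB : symmx B := sym _ sW.
have sC : symmx C := sym _ sY.
rewrite (GC _ _ sB sA) (GC _ _ sC sB) (GC _ _ sC sA).
rewrite (bw_metricC pS (sG _ _ sB sC) sA).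
rewrite -/(G A B) mulNmx raddfN /= => hA hB hC.
move: GE hA hB hC.
(* Here [Y] is hidden in C = L_S(Y); cyclicity and self-adjointness bring it out as the last factor,
   as in the other two traces. *)
have -> : \tr (lyapunov C W *m Z) = \tr (lyapunov S (W *m Z + Z *m W) *m Y).
  rewrite [RHS]mxtrace_lyapunov [RHS]mxtrace_mulC -/C /lyapunov mulmxDl (mulmxDr C).
  rewrite !mxtraceD -!mulmxA; congr (_ + _).
  by rewrite [LHS]mxtrace_mulC -mulmxA.
(* In the expansion the words with [S] at an end cancel and those with [S] in the middle occur
   twice. *)
have : \tr ((lyapunov A W + lyapunov B Z - lyapunov S (W *m Z + Z *m W)) *m Y)
    = 2 * \tr ((Z *m S *m W + W *m S *m Z) *m Y).
  rewrite -mxtraceZ scalemxAl; congr (\tr (_ *m _)).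
  rewrite /A /B /lyapunov !mulmxDl !mulmxDr !mulmxA.
  move: (S *m Z *m W) (S *m W *m Z) (Z *m S *m W) (W *m S *m Z).
  move: (W *m Z *m S) (Z *m W *m S) => a b c d e f.
  by apply/matrixP => i j; rewrite !mxE; ring.
rewrite mulmxBl (mulmxDl (lyapunov A W)) raddfB raddfD /=.
move: (bw_metric S A (G B C)) (bw_metric S B (G A C)) (bw_metric S (G A B) C).
move: (\tr (lyapunov A W *m Y)) (\tr (lyapunov B Z *m Y)) (\tr (G A B *m Y)).
move: (\tr (lyapunov S (W *m Z + Z *m W) *m Y)).
move: (\tr ((Z *m S *m W + W *m S *m Z) *m Y)).
clear => *; lra.
Qed.
End BuresWasserstein.

(** * The transport equation in a fixed frame *)

Section MatrixCurves.
Variables (R : realType) (m n : nat).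

Lemma is_derive_mxP (F : R -> 'M[R]_(m, n)) (F' : 'M[R]_(m, n)) (t : R) :
  is_derive t 1 F F' <-> forall i j, is_derive t 1 (fun x => F x i j) (F' i j).
Proof.
split=> [[dF eF] i j|dF].
  apply: DeriveDef; first exact: (proj1 (derivable_mxP F t 1)).
  by rewrite -eF (derive_mx dF) mxE.
have dF' : derivable F t 1 by apply/derivable_mxP => i j; have [] := dF i j.
apply: DeriveDef => //; rewrite derive_mx //.
by apply/matrixP => i j; rewrite mxE; have [] := dF i j.
Qed.

Lemma continuous_sum (T : topologicalType) (F : 'I_n -> T -> R) :
  (forall i, continuous (F i)) -> continuous (fun x => \sum_i F i x).
Proof.
move=> cF x; have -> : (fun x => \sum_i F i x) = \sum_i F i.
  by apply/funext => y; rewrite fct_sumE.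
elim/big_ind: _ => [|f g|i _]; [exact: cst_continuous|exact: continuousD|].
exact: cF.
Qed.

End MatrixCurves.

Section MatrixProductCurves.
Variables (R : realType) (n : nat).
Local Notation M := 'M[R]_n.

Lemma is_derive_conj (P Q : M) (F : R -> M) (F' : M) (t : R) :
  is_derive t 1 F F' -> is_derive t 1 (fun x => P *m F x *m Q) (P *m F' *m Q).
Proof.
move=> /is_derive_mxP dF; apply/is_derive_mxP => i j.
rewrite mxE (_ : (fun x => _) = \sum_k \sum_l
    (P i l * Q k j) \*: (fun x => F x l k)); last first.
  apply/funext => x; rewrite fct_sumE mxE; apply: eq_bigr => k _.
  rewrite fct_sumE mxE mulr_suml; apply: eq_bigr => l _.
  by rewrite -[RHS]/(P i l * Q k j * F x l k); ring.
apply: is_derive_sum => k.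
rewrite mxE mulr_suml (_ : \sum_l _ = \sum_l (P i l * Q k j) *: F' l k).
  exact: is_derive_sum.
apply: eq_bigr => l _.
by rewrite -[RHS]/(P i l * Q k j * F' l k); ring.
Qed.

Lemma continuous_conj (T : topologicalType) (P Q : M) (F : T -> M) i j :
  continuous F -> continuous (fun x => (P *m F x *m Q) i j).
Proof.
move=> cF; rewrite (_ : (fun x => _) = fun x => \sum_k \sum_l
    (P i l * Q k j) * F x l k); last first.
  apply/funext => x; rewrite mxE; apply: eq_bigr => k _.
  by rewrite mxE mulr_suml; apply: eq_bigr => l _; ring.
apply: continuous_sum => k; apply: continuous_sum => l x.
apply: cvgM; first exact: cvg_cst.
apply: (@continuous_comp _ _ _ F (fun A : M => A l k)); first exact: cF.
exact: coord_continuous.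
Qed.

End MatrixProductCurves.

(** * The scalar transport equation *)

Section ScalarTransport.
Variables (R : realType) (s s' : R -> R).
Hypothesis s_gt0 : forall t : R, t \in `[0, 1] -> 0 < s t.
Hypothesis ds : forall t : R, is_derive t 1 s (s' t).

Lemma is_derive_sqrt_comp (t : R) : t \in `[0, 1] ->
  is_derive t 1 (fun x => Num.sqrt (s x)) (s' t / (2 * Num.sqrt (s t))).
Proof.
move=> t01; rewrite mulrC; apply: (@is_derive1_comp _ Num.sqrt s) => //.
by apply: is_derive1_sqrt; exact: s_gt0.
Qed.

(** The quotient v / sqrt s is continuous on [0, 1] with zero derivative inside, so the mean value
    theorem equates its end values. *)
Lemma scalar_transport_unique (v : R -> R) :
  {within `[0, 1], continuous v} ->
  (forall t : R, t \in `]0, 1[ -> is_derive t 1 v (s' t / (2 * s t) * v t)) ->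
  v 1 = Num.sqrt (s 1 / s 0) * v 0.
Proof.
move=> cv dv; pose q x := Num.sqrt (s x).
have q0 (t : R) : t \in `[0, 1] -> 0 < q t by move=> /s_gt0; rewrite sqrtr_gt0.
have dqV (t : R) : t \in `[0, 1] -> is_derive t 1 (fun x => (q x)^-1)
    (- (q t) ^- 2 *: (s' t / (2 * q t))).
  move=> t01; apply: is_deriveV; first by rewrite gt_eqF // q0.
  exact: is_derive_sqrt_comp.
have cw : {within `[0, 1], continuous (v * (fun x => (q x)^-1))}.
  move=> x; apply: continuousM; first exact: cv.
  apply: derivable_within_continuous => t t01.
  by have [] := dqV t t01.
have dw (t : R) : t \in `]0, 1[ -> is_derive t 1 (v * (fun x => (q x)^-1)) 0.
  move=> t01; have t01' : t \in `[0, 1] by exact: subset_itv_oo_cc.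
  apply: (@is_derive_eq _ _ _ _ _ _ _ _ (is_deriveM (dv t t01) (dqV t t01'))).
  have -> : s t = q t ^+ 2 by rewrite sqr_sqrtr // ltW // s_gt0.
  by rewrite /GRing.scale /=; field; rewrite gt_eqF // q0.
have [//|c _] := MVT (a := 0) (b := 1) (df := fun=> 0) _ dw cw.
rewrite mul0r /GRing.mul /= => /eqP; rewrite subr_eq0 => /eqP.
have i0 : (0 : R) \in `[0, 1] by rewrite in_itv /= lexx ler01.
have i1 : (1 : R) \in `[0, 1] by rewrite in_itv /= lexx ler01.
have q00 := lt0r_neq0 (q0 _ i0); have q10 := lt0r_neq0 (q0 _ i1).
rewrite sqrtrM ?ltW ?s_gt0 // sqrtrV ?ltW ?s_gt0 // -/(q 1) -/(q 0).
move=> /(congr1 (fun x => x * q 1)); rewrite mulfVK // => ->.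
by rewrite mulrC [v 0 * _]mulrC mulrA.
Qed.

(** The existence counterpart: an explicit solution with value [x] at time 0. *)
Lemma is_derive_scalar_transport (x t : R) : t \in `[0, 1] ->
  is_derive t 1 (fun t => Num.sqrt (s t / s 0) * x)
    (s' t / (2 * s t) * (Num.sqrt (s t / s 0) * x)).
Proof.
move=> t01.
have i0 : (0 : R) \in `[0, 1] by rewrite in_itv /= lexx ler01.
have s0 := s_gt0 i0.
have e u : Num.sqrt (s u / s 0) = (Num.sqrt (s 0))^-1 * Num.sqrt (s u).
  by rewrite mulrC sqrtrM ?invr_ge0 ?ltW // sqrtrV // ltW.
rewrite (_ : (fun t => _) = ((Num.sqrt (s 0))^-1 * x) \*:
    (fun t => Num.sqrt (s t))); last first.
  apply/funext => u; rewrite e.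
  by rewrite -[RHS]/((Num.sqrt (s 0))^-1 * x * Num.sqrt (s u)); ring.
apply: is_derive_eq (is_deriveZ _ (is_derive_sqrt_comp t01)) _.
have st := s_gt0 t01; have qt : 0 < Num.sqrt (s t) by rewrite sqrtr_gt0.
rewrite e -[X in _ = _ / (2 * X) * _](sqr_sqrtr (ltW st)).
move: (s t) (s' t) (Num.sqrt (s t)) ((Num.sqrt (s 0))^-1) qt => a b q r q0.
rewrite -[LHS]/(r * x * (b / (2 * q))); field.
exact: lt0r_neq0.
Qed.
End ScalarTransport.

(** * Square roots and the geodesic in a common eigenframe *)

Section Geodesic.
Variables (R : realType) (n : nat).
Local Notation M := 'M[R]_n.
Implicit Types (A B P S T : M) (a b d : 'rV[R]_n).

(** One has L_(S+T)(S - T) = 2 (S^2 - T^2) = 0. Every symmetric matrix is some L_(S+T)(Y), so by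
    self-adjointness S - T is trace-orthogonal to Sym(n). *)
Lemma sqrtmx_unique S T : SPD S -> SPD T -> S *m S = T *m T -> S = T.
Proof.
move=> pS pT ST; have [sS pS'] := pS; have [sT pT'] := pT.
have pST : SPD (S + T).
  split; first by rewrite /symmx /= linearD /= sS sT.
  move=> u u0; rewrite mulmxDr mulmxDl mxE.
  by rewrite addr_gt0 // ?pS' ?pT'.
have sD : symmx (S - T) by rewrite /symmx /= linearB /= sS sT.
suff : S - T = 0 by move/eqP; rewrite subr_eq0 => /eqP.
apply: mxtrace_sym_inj => //; first by rewrite /symmx /= trmx0.
move=> W /(lyapunov_solvable pST)[Y sY <-].
rewrite -mxtrace_lyapunov (_ : lyapunov _ _ = 0) ?mul0mx //.
rewrite /lyapunov !(mulmxDl, mulmxDr, mulmxN, mulNmx) ST.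
move: (S *m T) (T *m S) (T *m T) => x y z.
by apply/matrixP => i j; rewrite !mxE; ring.
Qed.

Lemma sqrtmx_eq S T : SPD T -> T *m T = S -> sqrtmx S = T.
Proof.
move=> pT TS; rewrite /sqrtmx.
have [pU US] : [set U | SPD U /\ U *m U = S] (xget 0 [set U | SPD U /\ U *m U = S]).
  by apply: (@xgetPex _ _ [set U | SPD U /\ U *m U = S]); exists T.
by apply: sqrtmx_unique => //; rewrite US.
Qed.

Lemma mulmx_conj P A B : orthogonalmx P ->
  P *m A *m P^T *m (P *m B *m P^T) = P *m (A *m B) *m P^T.
Proof.
by move=> oP; rewrite !mulmxA -(mulmxA _ P^T P) oP mulmx1.
Qed.

Lemma SPD_unitmx S : SPD S -> S \in unitmx.
Proof.
move=> /SPD_diagonalizes[P [d [oP d0 ->]]].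
suff /mulmx1_unit[] : P *m diag_mx d *m P^T
    *m (P *m diag_mx (\row_i (d 0 i)^-1) *m P^T) = 1%:M by [].
rewrite mulmx_conj // mulmx_diag -(orthogonalmx_mulT oP).
congr (_ *m _); rewrite -[RHS]mulmx1; congr (_ *m _).
rewrite -diag_const_mx; congr diag_mx; apply/rowP => i; rewrite !mxE.
by rewrite divff // gt_eqF.
Qed.

Lemma bw_geodesic_diag P d b t : orthogonalmx P ->
  (forall i, 0 < d 0 i) -> (forall i, 0 < b 0 i) ->
  bw_geodesic (P *m diag_mx d *m P^T) (P *m diag_mx b *m P^T) t
  = P *m diag_mx (\row_i ((1 - t) * Num.sqrt (d 0 i) + t * Num.sqrt (b 0 i)) ^+ 2)
      *m P^T.
Proof.
move=> oP d0 b0.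
pose r (a : 'rV[R]_n) : 'rV[R]_n := \row_i Num.sqrt (a 0 i).
have r0 a : (forall i, 0 < a 0 i) -> forall i, 0 < r a 0 i.
  by move=> a0 i; rewrite mxE sqrtr_gt0.
have rr a : (forall i, 0 < a 0 i) -> diag_mx (r a) *m diag_mx (r a) = diag_mx a.
  move=> a0; rewrite mulmx_diag; congr diag_mx; apply/rowP => i.
  by rewrite !mxE -expr2 sqr_sqrtr // ltW.
have sq a : (forall i, 0 < a 0 i) ->
    sqrtmx (P *m diag_mx a *m P^T) = P *m diag_mx (r a) *m P^T.
  move=> a0; apply: sqrtmx_eq; last by rewrite mulmx_conj // rr.
  by apply/SPD_diag => //; exact: r0.
rewrite /bw_geodesic sq // !mulmx_conj //.
have pd : SPD (P *m diag_mx (r d) *m P^T) by apply/SPD_diag => //; exact: r0.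
(* All factors are diagonal in the frame [P], so this root is the product of the roots of the two
   end points; the inverse in front then cancels the first of them. *)
have -> : sqrtmx (P *m (diag_mx (r d) *m diag_mx b *m diag_mx (r d)) *m P^T)
    = P *m diag_mx (r d) *m P^T *m (P *m diag_mx (r b) *m P^T).
  rewrite mulmx_conj //; apply: sqrtmx_eq.
    rewrite mulmx_diag; apply/SPD_diag => // i.
    by rewrite mxE mulr_gt0 // r0.
  rewrite mulmx_conj //; congr (_ *m _ *m _).
  rewrite -{1}(rr b b0) !mulmx_diag; congr diag_mx; apply/rowP => i.
  by rewrite !mxE; ring.
rewrite mulKmx ?SPD_unitmx //.
have -> : (1 - t) *: (P *m diag_mx (r d) *m P^T) + t *: (P *m diag_mx (r b) *m P^T)
    = P *m diag_mx ((1 - t) *: r d + t *: r b) *m P^T.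
  by rewrite linearD !linearZ /= mulmxDr mulmxDl -!scalemxAr -!scalemxAl.
rewrite !trmx_mul trmxK tr_diag_mx mulmxA -mulmxA mulmxA mulmx_conj //.
rewrite mulmx_diag; congr (_ *m diag_mx _ *m _); apply/rowP => i.
by rewrite !mxE expr2.
Qed.

Lemma lyapunov_diag P a B : orthogonalmx P ->
  lyapunov (P *m diag_mx a *m P^T) (P *m B *m P^T)
  = P *m (\matrix_(i, j) ((a 0 i + a 0 j) * B i j)) *m P^T.
Proof.
move=> oP; rewrite /lyapunov !mulmx_conj // -mulmxDl -mulmxDr.
congr (_ *m _ *m _); apply/matrixP => i j.
by rewrite mul_mx_diag mul_diag_mx !mxE; ring.
Qed.

Lemma nabla_diag (nabla : (M -> M) -> (M -> M) -> M -> M) P a b B :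
  levi_civita (@bw_metric R n) nabla -> orthogonalmx P ->
  (forall i, 0 < a 0 i) -> symmx B ->
  nabla (cst (P *m diag_mx b *m P^T)) (cst (P *m B *m P^T)) (P *m diag_mx a *m P^T)
  = - (P *m (\matrix_(i, j)
        ((b 0 i + b 0 j) / (2 * (a 0 i + a 0 j)) * B i j)) *m P^T).
Proof.
move=> hnabla oP a0 sB.
have aij i j : a 0 i + a 0 j != 0 by rewrite gt_eqF // addr_gt0.
(* [z] and [W] are the preimages of Diag(b) and [B] under the Lyapunov operator of Diag(a). In Z S W
   + W S Z the entry (i, j) becomes (z_i a_i + z_j a_j) W_ij. *)
pose z : 'rV[R]_n := \row_i (b 0 i / (2 * a 0 i)).
pose W : M := \matrix_(i, j) (B i j / (a 0 i + a 0 j)).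
have sz : symmx (P *m diag_mx z *m P^T).
  by apply: symmx_conj; rewrite /symmx /= tr_diag_mx.
have sW : symmx (P *m W *m P^T).
  apply: symmx_conj; apply/matrixP => i j.
  by rewrite !mxE -[in LHS]sB mxE addrC.
have -> : P *m diag_mx b *m P^T
    = lyapunov (P *m diag_mx a *m P^T) (P *m diag_mx z *m P^T).
  rewrite lyapunov_diag //; congr (_ *m _ *m _); apply/matrixP => i j.
  rewrite !mxE; have [->|] := eqVneq i j; last by rewrite mulr0.
  by rewrite !mulr1n; field; rewrite gt_eqF.
have -> : P *m B *m P^T
    = lyapunov (P *m diag_mx a *m P^T) (P *m W *m P^T).
  rewrite lyapunov_diag //; congr (_ *m _ *m _); apply/matrixP => i j.
  by rewrite !mxE; field; exact: aij.
rewrite (nabla_cst hnabla) //; last by apply/SPD_diag.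
congr (- _); rewrite !mulmx_conj // -mulmxDl -mulmxDr.
congr (_ *m _ *m _); apply/matrixP => i j.
rewrite mulmx_diag -mulmxA mulmx_diag mul_mx_diag mul_diag_mx !mxE.
by field; rewrite aij !gt_eqF.
Qed.

End Geodesic.

(** * Transport along a curve with constant eigenframe *)

Section DiagonalTransport.
Variables (R : realType) (n : nat).
Local Notation M := 'M[R]_n.
Variable nabla : (M -> M) -> (M -> M) -> M -> M.
Hypothesis hnabla : levi_civita (@bw_metric R n) nabla.
Variables (P : M) (a a' : R -> 'rV[R]_n).
Hypothesis oP : orthogonalmx P.
Hypothesis a_gt0 : forall (t : R) i, t \in `[0, 1] -> 0 < a t 0 i.
Hypothesis da : forall (t : R) i, is_derive t 1 (fun x => a x 0 i) (a' t 0 i).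
Let c (t : R) : M := P *m diag_mx (a t) *m P^T.

Lemma covariant_derive_diag (V : R -> M) (t : R) :
  t \in `[0, 1] -> symmx (V t) ->
  covariant_derive nabla c V t = 'D_1 V t - P *m (\matrix_(i, j)
    ((a' t 0 i + a' t 0 j) / (2 * (a t 0 i + a t 0 j)) * (P^T *m V t *m P) i j))
    *m P^T.
Proof.
move=> t01 sV; have oP' := orthogonalmx_mulT oP.
have dc : is_derive t 1 c (P *m diag_mx (a' t) *m P^T).
  apply: is_derive_conj; apply/is_derive_mxP => i j; rewrite mxE.
  rewrite (_ : (fun x => _) = fun x => a x 0 i *+ (i == j)); last first.
    by apply/funext => x; rewrite mxE.
  case: (i == j); first by rewrite !mulr1n; exact: da.
  by rewrite !mulr0n; exact: is_derive_cst.
rewrite /covariant_derive derive_val; congr (_ + _).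
have {1}-> : V t = P *m (P^T *m V t *m P) *m P^T.
  by rewrite !mulmxA oP' mul1mx -mulmxA oP' mulmx1.
rewrite (nabla_diag _ hnabla) // => [i|]; first exact: a_gt0.
by rewrite -{2}(trmxK P); exact: symmx_conj.
Qed.

(** For a parallel [V] each entry of P^T V P solves the scalar equation with s = a_i + a_j, so its
    end value is forced. Conversely the scalar solutions assemble to a parallel field. *)
Lemma parallel_transport_diag (X Y : M) : symmx X ->
  parallel_transport nabla c X Y <->
  Y = P *m (\matrix_(i, j) (Num.sqrt ((a 1 0 i + a 1 0 j) / (a 0 0 i + a 0 0 j))
        * (P^T *m X *m P) i j)) *m P^T.
Proof.
move=> sX; have oP' := orthogonalmx_mulT oP.
pose s i j t := a t 0 i + a t 0 j; pose s' i j t := a' t 0 i + a' t 0 j.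
have s0 i j (t : R) : t \in `[0, 1] -> 0 < s i j t.
  by move=> t01; rewrite addr_gt0 // a_gt0.
have ds i j (t : R) : is_derive t 1 (s i j) (s' i j t) by exact: is_deriveD.
have conjK (A : M) : P *m (P^T *m A *m P) *m P^T = A.
  by rewrite !mulmxA oP' mul1mx -mulmxA oP' mulmx1.
have conjV (A : M) : P^T *m (P *m A *m P^T) *m P = A.
  by rewrite !mulmxA oP mul1mx -mulmxA oP mulmx1.
split=> [[V [sV cV dV <- <-]]|->].
  rewrite -[LHS]conjK; congr (_ *m _ *m _); apply/matrixP => i j.
  rewrite [RHS]mxE.
  apply: (scalar_transport_unique (s0 i j) (ds i j)
    (v := fun t => (P^T *m V t *m P) i j)); first exact: continuous_conj.
  move=> t t01; have t01' : t \in `[0, 1] by exact: subset_itv_oo_cc.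
  have [vt] := dV t t01; rewrite (covariant_derive_diag t01' (sV t t01')) => /eqP.
  rewrite subr_eq0 => /eqP dVt.
  have : is_derive t 1 V ('D_1 V t) by exact: DeriveDef.
  move=> /(is_derive_conj P^T P) /is_derive_mxP/(_ i j).
  by rewrite dVt conjV mxE.
(* The candidate in the frame [P]: the asserted end value with time 1 replaced by [t]. *)
pose v t : M := \matrix_(i, j) (Num.sqrt (s i j t / s i j 0) * (P^T *m X *m P) i j).
pose V t := P *m v t *m P^T.
have sV t : symmx (V t).
  apply: symmx_conj; apply/matrixP => i j; rewrite mxE [LHS]mxE [RHS]mxE /s addrC.
  rewrite [a 0 0 j + _]addrC; congr (_ * _).
  have sX' : symmx (P^T *m X *m P) by rewrite -{2}(trmxK P); exact: symmx_conj.
  by rewrite -[in LHS]sX' mxE.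
have dV (t : R) : t \in `[0, 1] -> is_derive t 1 V (P *m (\matrix_(i, j)
    (s' i j t / (2 * s i j t) * v t i j)) *m P^T).
  move=> t01; apply: is_derive_conj; apply/is_derive_mxP => i j.
  rewrite (_ : (fun x => _) = fun x => Num.sqrt (s i j x / s i j 0)
     * (P^T *m X *m P) i j); last by apply/funext => x; rewrite mxE.
  rewrite !mxE.
  exact: (is_derive_scalar_transport (s0 i j) (ds i j)).
exists V; split.
- by move=> t _; exact: sV.
- by apply: derivable_within_continuous => t t01; have [] := dV t t01.
- move=> t t01; have t01' : t \in `[0, 1] by exact: subset_itv_oo_cc.
  have [Vt Ve] := dV t t01'; split=> //.
  by rewrite covariant_derive_diag // Ve /V conjV subrr.
- rewrite /V -[RHS]conjK; congr (_ *m _ *m _); apply/matrixP => i j.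
  rewrite [LHS]mxE divff ?sqrtr1 ?mul1r // gt_eqF // s0 //.
  by rewrite in_itv /= lexx ler01.
- by [].
Qed.

End DiagonalTransport.
Unset Implicit Arguments.

(** The equivalence holds both the existence of a parallel field from [X] and the uniqueness of its
    end value. *)
Theorem mainTheorem3 (R : realType) (n : nat)
    (nabla : ('M[R]_n -> 'M[R]_n) -> ('M[R]_n -> 'M[R]_n) -> 'M[R]_n -> 'M[R]_n)
    (hnabla : levi_civita (@bw_metric R n) nabla)
    (S L P : 'M[R]_n) (d delta : 'rV[R]_n)
    (hS : SPD S) (hL : SPD L) (hSL : S *m L = L *m S)
    (hP : orthogonalmx P)
    (hSd : S = P *m diag_mx d *m P^T)
    (hLd : L = P *m diag_mx delta *m P^T)
    (X : 'M[R]_n) (hX : symmx X) (Y : 'M[R]_n) :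
  parallel_transport nabla (bw_geodesic S L) X Y <->
  Y = P *m (\matrix_(i, j)
        (Num.sqrt ((delta 0 i + delta 0 j) / (d 0 i + d 0 j))
         * (P^T *m X *m P) i j)) *m P^T.
Proof.
have d0 : forall i, 0 < d 0 i by apply/(SPD_diag d hP); rewrite -hSd.
have delta0 : forall i, 0 < delta 0 i by apply/(SPD_diag delta hP); rewrite -hLd.
(* In the frame [P] the geodesic has eigenvalues r_i^2 with r_i affine in [t]; [a'] is their
   derivative. *)
pose r (t : R) i := (1 - t) * Num.sqrt (d 0 i) + t * Num.sqrt (delta 0 i).
pose a (t : R) : 'rV[R]_n := \row_i (r t i ^+ 2).
pose a' (t : R) : 'rV[R]_n :=
  \row_i (2 * r t i * (Num.sqrt (delta 0 i) - Num.sqrt (d 0 i))).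
have -> : bw_geodesic S L = fun t => P *m diag_mx (a t) *m P^T.
  by apply/funext => t; rewrite hSd hLd bw_geodesic_diag.
have a0 i : a 0 0 i = d 0 i.
  by rewrite mxE /r subr0 mul1r mul0r addr0 sqr_sqrtr // ltW.
have a1 i : a 1 0 i = delta 0 i.
  by rewrite mxE /r subrr mul0r mul1r add0r sqr_sqrtr // ltW.
have a_gt0 (t : R) i : t \in `[0, 1] -> 0 < a t 0 i.
  rewrite in_itv /= => /andP[t0 t1]; rewrite mxE exprn_gt0 //.
  have q0 : 0 < Num.sqrt (d 0 i) by rewrite sqrtr_gt0.
  have q1 : 0 < Num.sqrt (delta 0 i) by rewrite sqrtr_gt0.
  (* For t > 0 the second summand is positive; at t = 0 it vanishes and the first one is the root of
     [d 0 i]. *)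
  rewrite /r; have [->|t0'] := eqVneq t 0; first by rewrite subr0 mul1r mul0r addr0.
  apply: ltr_wpDl; last by rewrite mulr_gt0 // lt0r t0'.
  by rewrite mulr_ge0 ?subr_ge0 // ltW.
have da (t : R) i : is_derive t 1 (fun x => a x 0 i) (a' t 0 i).
  have dr : is_derive t 1 (r^~ i) (Num.sqrt (delta 0 i) - Num.sqrt (d 0 i)).
    rewrite (_ : r^~ i = cst (Num.sqrt (d 0 i))
      + (Num.sqrt (delta 0 i) - Num.sqrt (d 0 i)) \*: id).
      by apply: is_derive_eq; rewrite add0r /GRing.scale /= mulr1.
    apply/funext => x.
    rewrite -[RHS]/(Num.sqrt (d 0 i)
      + (Num.sqrt (delta 0 i) - Num.sqrt (d 0 i)) * x) /r; ring.
  rewrite mxE (_ : (fun x => _) = (r^~ i) ^+ 2).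
    by apply: is_derive_eq; rewrite /GRing.scale /= expr1.
  by apply/funext => x; rewrite mxE.
rewrite (parallel_transport_diag hnabla hP a_gt0 da) //.
have e : (\matrix_(i, j) (Num.sqrt ((a 1 0 i + a 1 0 j) / (a 0 0 i + a 0 0 j))
        * (P^T *m X *m P) i j))
  = \matrix_(i, j) (Num.sqrt ((delta 0 i + delta 0 j) / (d 0 i + d 0 j))
         * (P^T *m X *m P) i j).
  by apply/matrixP => i j; rewrite [LHS]mxE [RHS]mxE !a0 !a1.
by rewrite e.
Qed.
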